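(* Let $b,c\in[0,1]$ and let $\pi$ be a monotone $(b,c)$-balanced contention resolution scheme for the bipartite matching polytope, i.e., for every finite bipartite graph $G$, $\pi$ restricted to $G$ is a monotone $(b,c)$-balanced contention resolution scheme for $P_{\mathcal{M}(G)}$. Then $c\le\beta(b)$.
   Context: For a graph $G=(V,E)$, $\mathcal{M}(G)$ is the family of matchings and $P_{\mathcal{M}(G)}$ the matching polytope (for bipartite $G$ equal to $\{x\ge0: x(\delta(v))\le1\ \forall v\}$). For $x\in[0,1]^E$, $R(x)$ is a random subset of $E$ containing each $e$ independently with probability $x_e$. A $(b,c)$-balanced CR scheme for $P=P_{\mathcal F}$ is a procedure that for every $x\in bP$ and $A\subseteq\mathrm{supp}(x)$ returns a (possibly random) $\pi_x(A)\subseteq A$ with $\pi_x(A)\in\mathcal F$ such that $\Pr[e\in\pi_x(R(x))]\ge c\,x_e$ for all $e\in\mathrm{supp}(x)$; it is monotone if for all $x\in bP$, $\Pr[e\in\pi_x(A)]\ge\Pr[e\in\pi_x(B)]$ whenever $e\in A\subseteq B\subseteq\mathrm{supp}(x)$. $\beta(b)=\mathbb{E}\big[\frac{1}{1+\max\{X_1,X_2\}}\big]$ with $X_1,X_2$ independent Poisson random variables with parameter $b$. *)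

(* Defs.v *)
From HB Require Import structures.
From mathcomp Require Import all_boot all_order all_algebra.
From mathcomp Require Import all_classical all_reals all_analysis.

Set Implicit Arguments.
Unset Strict Implicit.
Unset Printing Implicit Defensive.

Import Order.TTheory GRing.Theory Num.Theory.
Local Open Scope ring_scope.

Record fdist (R : realType) (T : finType) := FDist {
  fdist_pmf :> {ffun T -> R};
  fdist_ge0 : forall t, 0 <= fdist_pmf t;
  fdist_sum1 : \sum_t fdist_pmf t = 1 }.

Definition Pr (R : realType) (T : finType) (d : fdist R T) (A : pred T) : R :=
  \sum_(t | A t) d t.

Record sgraph := SGraph {
  vertex : finType;
  edge_set : {set {set vertex}};
  edge_card : forall e, e \in edge_set -> #|e| = 2%N }.

Definition edge (G : sgraph) : finType := {e : {set vertex G} | e \in edge_set G}.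

Definition bipartite (G : sgraph) : Prop :=
  exists U : {set vertex G},
    forall e, e \in edge_set G -> #|e :&: U| = 1%N.

Definition matchings (G : sgraph) : {set {set edge G}} :=
  [set M : {set edge G} |
    [forall e in M, forall f in M, (e != f) ==> [disjoint val e & val f]]].

Section ContentionResolution.
Variables (R : realType) (E : finType).
Implicit Types (F : {set {set E}}) (x : {ffun E -> R}) (A B : {set E}).

(* The convex hull of the characteristic vectors of the members of F. *)
Definition polytope F x : Prop :=
  exists w : {set E} -> R,
    [/\ forall A, A \in F -> 0 <= w A,
        \sum_(A in F) w A = 1
      & forall e, x e = \sum_(A in F) w A * (e \in A)%:R].

Definition scaled (b : R) (P : {ffun E -> R} -> Prop) x : Prop :=
  exists2 y : {ffun E -> R}, P y & forall e, x e = b * y e.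

Definition supp x : {set E} := [set e | x e != 0].

(* The probability that R(x) = A. *)
Definition random_set_pmf x A : R :=
  (\prod_(e in A) x e) * \prod_(e in ~: A) (1 - x e).

(* pi x A is the law of the random set pi_x(A).  The value of pi x A is
   unconstrained junk unless x \in b P and A \subset supp x. *)
Definition cr_procedure : Type := {ffun E -> R} -> {set E} -> fdist R {set E}.

(* Pr[e \in pi_x(R(x))], the randomness of pi_x being independent of R(x).
   Almost surely R(x) \subset supp x. *)
Definition selection_prob (pi : cr_procedure) x (e : E) : R :=
  \sum_(A : {set E} | A \subset supp x)
    random_set_pmf x A * Pr (pi x A) [pred B : {set E} | e \in B].

Definition balanced_cr_scheme (b c : R) F (pi : cr_procedure) : Prop :=
  forall x, scaled b (polytope F) x ->
    (forall A, A \subset supp x ->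
       forall B, pi x A B != 0 -> B \subset A /\ B \in F) /\
    (forall e, e \in supp x -> c * x e <= selection_prob pi x e).

Definition monotone_cr_scheme (b : R) F (pi : cr_procedure) : Prop :=
  forall x, scaled b (polytope F) x ->
  forall (e : E) A B, e \in A -> A \subset B -> B \subset supp x ->
    Pr (pi x B) [pred S : {set E} | e \in S]
      <= Pr (pi x A) [pred S : {set E} | e \in S].

End ContentionResolution.

(* Independence of X_1 and X_2 is expressed by the product of their laws.  The
   second argument of poisson_prob is not used by its definition; a rate of 0
   gives the Dirac measure at 0. *)
Definition beta (R : realType) (b : R) : \bar R :=
  ('E_(poisson_prob b 0%N \x poisson_prob b 0%N)
    [(fun X : nat * nat => (1 + (maxn X.1 X.2)%:R)^-1)%R])%E.

(* Main.v *)
(* Apply the scheme to the complete bipartite graph with sides of size N = n + 1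
   and x = b / N on every edge.  For e in A, monotonicity bounds the probability
   of selecting e from A by that of selecting e from the star of A at the
   endpoint of e of larger degree.  At most one edge of a star is selected and,
   by symmetry, which edges of a star have their larger endpoint at its centre
   depends in law on the size of the star alone, so a star of size k can be
   charged 1 / k for each such edge.  Summing up gives
   c <= E[1 / (1 + max(X, Y))] with X, Y independent binomials of parameters
   n and b / N, and the Poisson limit n -> oo turns this into c <= beta b. *)

Require Import Defs.
From mathcomp Require Import all_boot all_order all_algebra.
From mathcomp Require Import all_classical all_reals all_analysis.
From mathcomp Require Import measurable_realfun ring.
From mathcomp Require Import fintype finset.
Import Order.TTheory GRing.Theory Num.Theory.
Import numFieldNormedType.Exports.
Local Open Scope ring_scope.

Set Implicit Arguments.
Unset Strict Implicit.
Unset Printing Implicit Defensive.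

(** * Random subsets *)

Section RandomSubset.
Variables (R : realType) (E : finType) (p : R).
Implicit Types (A B D S T : {set E}) (e : E) (f g : {set E} -> R).

(* The expectation of f at a random subset of D that contains each element of D
   independently with probability p. *)
Definition expect D f : R :=
  \sum_(S : {set E} | S \subset D) p ^+ #|S| * (1 - p) ^+ #|D :\: S| * f S.

Lemma eq_expect D f g : (forall S : {set E}, S \subset D -> f S = g S) ->
  expect D f = expect D g.
Proof. by move=> fg; apply: eq_bigr => S SD; rewrite fg. Qed.

Lemma expectD D f g : expect D (fun S => f S + g S) = expect D f + expect D g.
Proof. by rewrite -big_split; apply: eq_bigr => S _; rewrite mulrDr. Qed.

Lemma expectZ D a f : expect D (fun S => a * f S) = a * expect D f.
Proof. by rewrite mulr_sumr; apply: eq_bigr => S _; rewrite mulrCA. Qed.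

Lemma expect_sum (I : finType) (P : pred I) D (f : I -> {set E} -> R) :
  expect D (fun S => \sum_(i | P i) f i S) = \sum_(i | P i) expect D (f i).
Proof. by rewrite exchange_big; apply: eq_bigr => S _; rewrite mulr_sumr. Qed.

(** The traces of the random subset on two disjoint sets are independent: a subset of the union
    amounts to its pair of traces, and the weights multiply. *)
Lemma expect_setU D1 D2 f : [disjoint D1 & D2] ->
  expect (D1 :|: D2) f =
    expect D1 (fun S => expect D2 (fun T => f (S :|: T))).
Proof.
move=> D12; have D120 : D1 :&: D2 = set0 by apply/eqP; rewrite setI_eq0.
rewrite /expect.
under [RHS]eq_bigr do rewrite mulr_sumr.
rewrite pair_big_dep.
rewrite (reindex_onto (fun ST : {set E} * {set E} => ST.1 :|: ST.2)
          (fun A => (A :&: D1, A :&: D2))) /=; last first.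
  by move=> A AD; rewrite -setIUr; apply/setIidPl.
apply: eq_big => [[S T]|[S T]] /=.
  apply/andP/andP => [[STD /eqP[<- <-]]|[SD TD]]; first by rewrite !subsetIr.
  split; first exact: setUSS.
  have SD2 : S :&: D2 = set0 by apply/eqP; rewrite -subset0 -D120 setSI.
  have TD1 : T :&: D1 = set0.
    by apply/eqP; rewrite -subset0 -D120 (finset.setIC D1) setSI.
  by rewrite !setIUl SD2 TD1 setU0 set0U (setIidPl SD) (setIidPl TD).
move=> /andP[_ /eqP[ST1 ST2]].
have SD : S \subset D1 by rewrite -ST1 subsetIr.
have TD : T \subset D2 by rewrite -ST2 subsetIr.
have ST0 : [disjoint S & T] by rewrite (disjointWl SD) // (disjointWr TD).
have -> : #|S :|: T| = (#|S| + #|T|)%N.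
  by rewrite cardsU (eqP (_ : S :&: T == set0)) ?setI_eq0 // cards0 subn0.
have -> : #|(D1 :|: D2) :\: (S :|: T)| = (#|D1 :\: S| + #|D2 :\: T|)%N.
  have DST : (D1 :\: S) :&: (D2 :\: T) = set0.
    by apply/eqP; rewrite -subset0 -D120 setISS ?subsetDl.
  rewrite -[RHS]subn0 -(cards0 E) -DST -cardsU; congr #|pred_of_set _|.
  apply/setP=> x; rewrite !inE.
  have D12x : ~~ ((x \in D1) && (x \in D2)) by rewrite -in_setI D120 inE.
  move: (subsetP SD x) (subsetP TD x) D12x.
  by do 4!case: (_ \in _) => //=; do ?move=> /(_ isT).
by rewrite !exprD; ring.
Qed.

Lemma expect_card D (h : nat -> R) :
  expect D (fun S => h #|S|) =
    \sum_(k < #|D|.+1)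
      ('C(#|D|, k)%:R * p ^+ k * (1 - p) ^+ (#|D| - k)) * h k.
Proof.
(* [inord] is faithful here: a subset of [D] has at most [#|D|] elements. *)
rewrite /expect (partition_big (fun S : {set E} => inord #|S| : 'I_#|D|.+1)
  xpredT) //=.
apply: eq_bigr => k _.
transitivity (\sum_(S : {set E} | (S \subset D) && (#|S| == k))
   p ^+ k * (1 - p) ^+ (#|D| - k) * h k).
  apply: eq_big => [S|S /andP[SD /eqP <-]].
    case: (boolP (S \subset D)) => //= SD.
    by rewrite -val_eqE /= inordK // ltnS subset_leq_card.
  by rewrite cardsDS // inordK // ltnS subset_leq_card.
rewrite big_const iter_addr_0 -[LHS]mulr_natl.
have -> : #|[pred S : {set E} | (S \subset D) && (#|S| == k)]| = 'C(#|D|, k).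
  by rewrite -cards_draws cardsE.
by rewrite !mulrA.
Qed.

Lemma expect_cst D a : expect D (fun=> a) = a.
Proof.
rewrite (expect_card D (fun=> a)) -mulr_suml -[RHS]mul1r; congr (_ * _).
rewrite -[RHS](expr1n _ #|D|) -[X in X ^+ _](subrK p 1) exprDn.
by apply: eq_bigr => k _; rewrite -mulr_natl; ring.
Qed.

Lemma expect_set1 e f :
  expect [set e] f = p * f [set e] + (1 - p) * f set0.
Proof.
rewrite /expect (bigD1 [set e]) //= (bigD1 set0) /=; last first.
  by rewrite sub0set eq_sym; apply/set0Pn; exists e; rewrite inE.
rewrite big1 ?addr0; last first.
  by move=> S; rewrite subset1; case: (S == [set e]); case: (S == set0).
by rewrite cards1 setDv cards0 setD0 cards1 !expr1 !expr0 mulr1 mul1r.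
Qed.

(** Condition on whether [e] is drawn; the outcomes without [e] contribute nothing. *)
Lemma expect_setU1 D e f : e \notin D ->
  (forall S, e \notin S -> f S = 0) ->
  expect (e |: D) f = p * expect D (fun S => f (e |: S)).
Proof.
move=> eD f0; rewrite expect_setU ?disjoints1 // expect_set1.
rewrite [X in _ + _ * X](@eq_expect _ _ (fun=> 0)) => [|S SD].
  by rewrite expect_cst mulr0 addr0.
by rewrite set0U f0 //; apply: contra eD; apply: (subsetP SD).
Qed.

Lemma expect_exchange (D1 D2 : {set E}) (F : {set E} -> {set E} -> R) :
  expect D1 (fun S => expect D2 (F S)) =
    expect D2 (fun T => expect D1 (F^~ T)).
Proof.
rewrite /expect; under eq_bigr do rewrite mulr_sumr.
rewrite exchange_big; apply: eq_bigr => T _.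
by rewrite mulr_sumr; apply: eq_bigr => S _; rewrite mulrCA.
Qed.

Hypothesis p01 : 0 <= p <= 1.

Lemma le_expect D f g : (forall S : {set E}, S \subset D -> f S <= g S) ->
  expect D f <= expect D g.
Proof.
move=> fg; apply: ler_sum => S SD; apply: ler_wpM2l; last exact: fg.
by case/andP: p01 => p0 p1; rewrite mulr_ge0 ?exprn_ge0 ?subr_ge0.
Qed.

End RandomSubset.

Definition binom_pmf (R : realType) (n : nat) (p : R) (k : nat) : R :=
  'C(n, k)%:R * p ^+ k * (1 - p) ^+ (n - k).

Lemma binom_pmf_ge0 (R : realType) n (p : R) k : 0 <= p <= 1 ->
  0 <= binom_pmf n p k.
Proof. by case/andP=> p0 p1; rewrite !mulr_ge0 ?exprn_ge0 ?subr_ge0. Qed.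

Lemma sum_binom_pmf (R : realType) n (p : R) :
  \sum_(k < n.+1) binom_pmf n p k = 1.
Proof.
by have := expect_cst p [set: 'I_n] 1; rewrite (expect_card p _ (fun=> 1))
  cardsT card_ord; under eq_bigr do rewrite mulr1.
Qed.

(* The expectation of 1 / (1 + max(X, Y)) for independent binomial X and Y. *)
Definition binom_beta (R : realType) (n : nat) (p : R) : R :=
  \sum_(i < n.+1) \sum_(j < n.+1)
    binom_pmf n p i * binom_pmf n p j * (1 + (maxn i j)%:R)^-1.

(** * Selection from a single star *)

Section Star.
Variables (R : realType) (E I : finType) (n : nat) (p : R) (l r : E -> I).
Hypothesis p01 : 0 <= p <= 1.
Hypothesis cardI : #|I| = n.+1.
Hypothesis lr_bij : bijective (fun e => (l e, r e)).

Local Notation EX := (expect p).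

(** [l] and [r] are the coordinates of a grid, so [r] identifies the fibre of [l] through [e] with
    [I]. *)
Lemma card_fiberD1 e : #|[set f | l f == l e] :\ e| = n.
Proof.
have [g lrK gK] := lr_bij.
have inj : injective (fun j => g (l e, j)).
  by move=> j j' /(congr1 (fun e => (l e, r e))); rewrite !gK => -[].
apply/eqP; rewrite -eqSS -[X in X == _]add1n.
have -> : 1%N = (e \in [set f | l f == l e]) by rewrite inE eqxx.
rewrite -cardsD1 -cardI -(card_imset _ inj).
apply/eqP; congr #|pred_of_set _|; apply/setP => f; rewrite !inE.
apply/eqP/imsetP => [lf|[j _ ->]]; last by case: (gK (l e, j)).
by exists (r f) => //; rewrite -lf lrK.
Qed.

Variables (q : {set E} -> E -> R) (h : nat -> R).
Hypothesis q1 : forall i (S : {set E}), \sum_(e in S | l e == i) q S e <= 1.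
Hypothesis h0 : forall k, 0 <= h k.

(* Conditionally on the star S at i, each e in S carries the same weight
   h (#|S| - 1), so that selecting at most one edge costs h (#|S| - 1), which is
   spread evenly over the edges of S. *)
Lemma star_bound i :
  \sum_(e | l e == i)
     p * EX ([set f | l f == l e] :\ e) (fun S => q (e |: S) e * h #|S|)
  <= \sum_(e | l e == i) p * \sum_(k < n.+1) binom_pmf n p k * (h k / (1 + k%:R)).
Proof.
set L := [set f | l f == i].
(* [#|S|] counts [e] itself, hence the predecessor. Its default value at [S = set0] multiplies an
   empty sum. *)
pose h1 k := h k.-1.
pose F (q : {set E} -> E -> R) e (S : {set E}) : R := (e \in S)%:R * (q S e * h1 #|S|).
have expectF (q' : {set E} -> E -> R) e : l e == i ->
  EX L (F q' e) =
    p * EX ([set f | l f == l e] :\ e) (fun S => q' (e |: S) e * h #|S|).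
  move=> /eqP le; have -> : L = e |: ([set f | l f == l e] :\ e).
    by rewrite setD1K ?inE ?le.
  rewrite expect_setU1 ?in_setD1 ?eqxx //; last first.
    by move=> S eS; rewrite /F (negbTE eS) mul0r.
  congr (_ * _); apply: eq_expect => S; rewrite subsetD1 => /andP[_ eS].
  by rewrite /F setU11 mul1r /h1 cardsU1 eS.
rewrite -(eq_bigr _ (fun e le => expectF q e le)).
(* The right-hand side is the same expression for the uniform selection [u] from the star, so the
   two sides can be compared for each [S] separately. *)
pose u (S : {set E}) (e : E) : R := #|S|%:R^-1.
rewrite [leRHS](_ : _ = \sum_(e | l e == i) EX L (F u e)); last first.
  apply: eq_bigr => e le; rewrite expectF //; congr (_ * _).
  rewrite -(card_fiberD1 e).
  rewrite -(expect_card p _ (fun k => h k / (1 + k%:R))).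
  apply: eq_expect => S; rewrite subsetD1 => /andP[_ eS].
  by rewrite /u cardsU1 eS mulrC addrC natr1.
rewrite -!expect_sum; apply: le_expect => // S SL.
have sumF q' : \sum_(e | l e == i) F q' e S =
    (\sum_(e in S | l e == i) q' S e) * h1 #|S|.
  rewrite mulr_suml (bigID (mem S)) /= [X in _ + X]big1 ?addr0; last first.
    by move=> e /andP[_ /negbTE eS]; rewrite /F eS mul0r.
  apply: eq_big => [e|e /andP[_ /= eS]]; first by rewrite andbC.
  by rewrite /F eS mul1r.
rewrite !sumF; have [->|S0] := eqVneq S set0.
  by rewrite !big1 // => e; rewrite inE.
apply: ler_wpM2r; first exact: h0.
rewrite (le_trans (q1 i S)) // /u.
rewrite (eq_bigl (mem S)); last first.
  move=> e /=; case: (boolP (e \in S)) => //= eS.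
  by have := subsetP SL _ eS; rewrite inE.
by rewrite sumr_const -[X in _ <= X]mulr_natl divff // pnatr_eq0 cards_eq0.
Qed.

End Star.

(** * Selection from the whole grid *)

Section Grid.
Variables (R : realType) (E I : finType) (n : nat) (p : R) (l r : E -> I).
Hypothesis p01 : 0 <= p <= 1.
Hypothesis cardI : #|I| = n.+1.
Hypothesis lr_bij : bijective (fun e => (l e, r e)).

Local Notation EX := (expect p).


Variable q : {set E} -> E -> R.
Hypothesis q_mono : forall e (A B : {set E}),
  e \in A -> A \subset B -> q B e <= q A e.
Hypothesis ql : forall i (S : {set E}), \sum_(e in S | l e == i) q S e <= 1.
Hypothesis qr : forall i (S : {set E}), \sum_(e in S | r e == i) q S e <= 1.

(** If one endpoint of an edge has [k] further edges, these are the chances that the other endpoint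
    has at most [k], respectively fewer than [k]. Ties are thus counted once, for the left star. *)
Let hl k := \sum_(j < n.+1) binom_pmf n p j * (j <= k)%N%:R.
Let hr k := \sum_(j < n.+1) binom_pmf n p j * (j < k)%N%:R.

Let rl_bij : bijective (fun e => (r e, l e)).
Proof.
have [g lrK gK] := lr_bij; exists (fun ij => g (ij.2, ij.1)) => [e|[i j]] /=.
  exact: lrK.
by case: (gK (j, i)) => -> ->.
Qed.

(* In A, keep only the star at the left endpoint of e if its degree is at least
   that of the right endpoint, and only the star at the right endpoint otherwise. *)
Lemma edge_bound e :
  EX [set: E] (fun A => (e \in A)%:R * q A e) <=
    p * EX ([set f | l f == l e] :\ e) (fun S => q (e |: S) e * hl #|S|) +
    p * EX ([set f | r f == r e] :\ e) (fun T => q (e |: T) e * hr #|T|).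
Proof.
set L := [set f | l f == l e] :\ e; set Rt := [set f | r f == r e] :\ e.
(* [Z] holds the edges that share no endpoint with [e]; the four pieces [[set e]], [L], [Rt] and [Z]
   are drawn independently. *)
set Z := ~: (e |: (L :|: Rt)).
have cL : #|L| = n by exact: (card_fiberD1 cardI lr_bij).
have cR : #|Rt| = n by exact: (card_fiberD1 cardI rl_bij).
have -> : [set: E] = e |: (L :|: (Rt :|: Z)).
  by rewrite (finset.setUA L) finset.setUA finset.setUCr.
have eD : e \notin L :|: (Rt :|: Z) by rewrite !inE eqxx.
have LR : [disjoint L & Rt].
  rewrite -setI_eq0; apply/eqP/setP => f; rewrite !inE.
  apply/negbTE/negP => /andP[/andP[fe /eqP lf] /andP[_ /eqP rf]].
  by case/eqP: fe; apply: (bij_inj lr_bij); rewrite /= lf rf.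
have LZ : [disjoint L & Z].
  by rewrite -setI_eq0; apply/eqP/setP => f; rewrite !inE;
     case: (f == e); case: (l f == l e); case: (r f == r e).
have RZ : [disjoint Rt & Z].
  by rewrite -setI_eq0; apply/eqP/setP => f; rewrite !inE;
     case: (f == e); case: (l f == l e); case: (r f == r e).
rewrite expect_setU1 //; last by move=> S /negbTE ->; rewrite mul0r.
rewrite -mulrDr; apply: ler_wpM2l; first by case/andP: p01.
rewrite expect_setU; last first.
  by rewrite -setI_eq0 finset.setIUr finset.setU_eq0 !setI_eq0 LR LZ.
pose G (S T : {set E}) : R := (#|T| <= #|S|)%N%:R * q (e |: S) e +
  (#|S| < #|T|)%N%:R * q (e |: T) e.
apply: (@le_trans _ _ (EX L (fun S => EX Rt (G S)))).
  apply: le_expect => // S SL; rewrite expect_setU //.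
  (* [G S T] ignores the part drawn in [Z], so it equals its own expectation over [Z]. *)
  apply: le_expect => // T TR; rewrite -[leRHS](expect_cst p Z).
  apply: le_expect => // U UZ; rewrite setU11 mul1r /G.
  case: leqP => _; rewrite ?mul0r ?mul1r ?addr0 ?add0r.
    by apply: q_mono; rewrite ?setU11 // finset.setUS ?finset.subsetUl.
  apply: q_mono; rewrite ?setU11 // finset.setUS // finset.setUCA.
  exact: finset.subsetUl.
rewrite (@eq_expect _ _ _ _ _ (fun S => EX Rt (fun T => (#|T| <= #|S|)%N%:R * q (e |: S) e)
   + EX Rt (fun T => (#|S| < #|T|)%N%:R * q (e |: T) e))); last first.
  by move=> S _; rewrite -expectD.
(* In the strict case the star that is kept is [T]; with [T] outside, averaging over [S] produces
   [hr #|T|]. *)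
rewrite expectD [X in _ + X]expect_exchange.
rewrite le_eqVlt; apply/orP; left; apply/eqP; congr (_ + _).
  apply: eq_expect => S _.
  rewrite (@eq_expect _ _ _ _ _ (fun T => q (e |: S) e * (#|T| <= #|S|)%N%:R)).
    by rewrite expectZ (expect_card _ _ (fun k => (k <= #|S|)%N%:R)) cR.
  by move=> T _; rewrite mulrC.
apply: eq_expect => T _.
rewrite (@eq_expect _ _ _ _ _ (fun S => q (e |: T) e * (#|S| < #|T|)%N%:R)).
  by rewrite expectZ (expect_card _ _ (fun k => (k < #|T|)%N%:R)) cL.
by move=> S _; rewrite mulrC.
Qed.

(** Group the left terms of [edge_bound] by left endpoint and the right terms by right endpoint, and
    apply [star_bound] to each group. *)
Lemma grid_bound :
  \sum_e EX [set: E] (fun A => (e \in A)%:R * q A e) <=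
    #|E|%:R * (p * binom_beta n p).
Proof.
have hl0 k : 0 <= hl k.
  by apply: sumr_ge0 => j _; rewrite mulr_ge0 ?binom_pmf_ge0.
have hr0 k : 0 <= hr k.
  by apply: sumr_ge0 => j _; rewrite mulr_ge0 ?binom_pmf_ge0.
apply: (le_trans (ler_sum _ (fun e _ => edge_bound e))).
rewrite big_split /= (partition_big l xpredT) //=.
rewrite [X in _ + X](partition_big r xpredT) //=.
pose c h := p * \sum_(k < n.+1) binom_pmf n p k * (h k / (1 + k%:R)).
have fold (s : E -> I) h : \sum_(i : I) \sum_(e | s e == i) c h = #|E|%:R * c h.
  transitivity (\sum_(e : E) c h); last by rewrite sumr_const mulr_natl.
  by rewrite (partition_big s xpredT).
apply: (@le_trans _ _ (#|E|%:R * c hl + #|E|%:R * c hr)).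
  rewrite -(fold l) -(fold r); apply: lerD; apply: ler_sum => i _.
    exact: (star_bound p01 cardI lr_bij).
  exact: (star_bound p01 cardI rl_bij).
rewrite -mulrDr -mulrDr le_eqVlt; apply/orP; left; apply/eqP.
congr (_ * (_ * _)); rewrite /hl /hr /binom_beta.
rewrite (eq_bigr (fun k : 'I_n.+1 => \sum_(j < n.+1) binom_pmf n p k *
    binom_pmf n p j * ((j <= k)%N%:R / (1 + k%:R)))); last first.
  by move=> k _; rewrite mulr_suml mulr_sumr; apply: eq_bigr => j _; rewrite !mulrA.
rewrite [X in _ + X](eq_bigr (fun k : 'I_n.+1 => \sum_(j < n.+1) binom_pmf n p j *
    binom_pmf n p k * ((j < k)%N%:R / (1 + k%:R)))); last first.
  move=> k _; rewrite mulr_suml mulr_sumr; apply: eq_bigr => j _.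
  by move: (binom_pmf n p k) (binom_pmf n p j) => x y; rewrite !mulrA (mulrC x).
(* After the exchange each pair [(i, j)] is charged through its larger coordinate: [i] if [j <= i],
   and [j] if [i < j]. *)
rewrite [X in _ + X]exchange_big -big_split; apply: eq_bigr => i _ /=.
rewrite -big_split; apply: eq_bigr => j _ /=.
rewrite -mulrDr; congr (_ * _).
by case: leqP; rewrite ?mul0r ?mul1r ?addr0 ?add0r.
Qed.

End Grid.

(** * The Poisson limit *)

Lemma poisson_prob_set1 (R : realType) (b : R) k : 0 < b ->
  poisson_prob b 0 [set k]%classic = (poisson_pmf b k)%:E.
Proof.
move=> b0; rewrite /poisson_prob b0 esum_set1 // lee_fin.
exact: poisson_pmf_ge0.
Qed.

Lemma poisson0_set1 (R : realType) : poisson_prob (0 : R) 0 [set 0%N]%classic = 1%E.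
Proof. by rewrite /poisson_prob ltxx diracE mem_set. Qed.

Local Open Scope ereal_scope.

(** Restricting the nonnegative integrand to a finite square gives a combination of indicators of
    singletons that lies below it. *)
Lemma beta_ge_sum (R : realType) (b : R) (m : nat) :
  \sum_(i < m) \sum_(j < m) poisson_prob b 0 [set (i : nat)]%classic *
    poisson_prob b 0 [set (j : nat)]%classic * ((1 + (maxn i j)%:R)^-1)%:E
  <= beta b.
Proof.
rewrite /beta expectation.unlock.
pose mu : {measure set (nat * nat) -> \bar R} := poisson_prob b 0 \x poisson_prob b 0.
pose f (X : nat * nat) : R := (1 + (maxn X.1 X.2)%:R)^-1%R.
have f0 z : (0 <= f z)%R by rewrite invr_ge0 addr_ge0.
rewrite pair_big -[leRHS]/(\int[mu]_z (f z)%:E) /=.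
pose A (u : 'I_m * 'I_m) := ([set (u.1 : nat)] `*` [set (u.2 : nat)])%classic.
have mA u : measurable (A u) by exact: measurableX.
have mf : measurable_fun [set: nat * nat] f.
  apply: (@measurableT_comp _ _ _ _ _ _ (fun k : nat => (1 + k%:R)^-1%R : R)) => //.
  exact: measurable_fun_maxn.
have mEf := (measurable_EFinP _ _).2 mf.
apply: (@le_trans _ _ (\int[mu]_z
  (\sum_(u : 'I_m * 'I_m) (f (u.1 : nat, u.2 : nat))%:E * (\1_(A u) z)%:E))).
  rewrite ge0_integral_sum //.
  - rewrite le_eqVlt; apply/orP; left; apply/eqP; apply: eq_bigr => u _.
    rewrite ge0_integralZl_EFin //; last exact/measurable_EFinP.
    rewrite integral_indic // classical_sets.setIT muleC; congr (_ * _).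
    by rewrite /mu [RHS]product_measure1E.
  - move=> u; apply: measurable_funeM; exact/measurable_EFinP.
  - by move=> u z _; rewrite mule_ge0 ?lee_fin.
apply: ge0_le_integral => //.
- by move=> z _; apply: sume_ge0 => u _; rewrite mule_ge0 ?lee_fin.
- apply: emeasurable_sum => u.
  apply: measurable_funeM; exact/measurable_EFinP.
move=> [i j] _.
(* The point [(i, j)] lies in exactly one of the singletons [A u], or in none. *)
case: (pselect (exists u : 'I_m * 'I_m, (u.1 : nat, u.2 : nat) = (i, j))).
  move=> [u0 uij]; rewrite (bigD1 u0) //= big1 ?adde0.
    by rewrite uij -EFinM lee_fin ler_piMr.
  move=> u uu0; rewrite indicE memNset ?mule0 // => -[/= ui uj].
  case/eqP: uu0; case: u0 u uij ui uj => [a c] [a' c'] /= [ai cj] a'i c'j.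
  by congr (_, _); apply: val_inj; rewrite /= ?ai ?cj.
move=> nu; rewrite big1 ?lee_fin // => u _.
rewrite indicE memNset ?mule0 // => -[/= ui uj]; apply: nu; exists u.
by rewrite ui uj.
Qed.

Local Close Scope ereal_scope.

Lemma ffact_le_exp n k : (n ^_ k <= n ^ k)%N.
Proof.
elim: k n => [|k IH] n; first by rewrite ffactn0.
case: n => [|n]; first by rewrite ffact0n.
rewrite ffactnS expnS leq_mul2l /= (leq_trans (IH _)) //.
by case: k {IH} => // k; rewrite leq_exp2r.
Qed.

(** With [N = n + 1], use ['C(n, k) <= N ^ k / k!] and [1 - b / N <= expR (- (b / N))]. Since
    [n - k = N - (k + 1)], the exponent is [- b + b * (k + 1) / N], whence the correction factor. *)
Lemma binom_pmf_le_poisson (R : realType) (b : R) n k :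
  0 < b <= 1 -> (k <= n)%N ->
  binom_pmf n (b / n.+1%:R) k <=
    poisson_pmf b k * expR (b * (k.+1)%:R / n.+1%:R).
Proof.
move=> /andP[b0 b1] kn; set N : R := n.+1%:R.
have N0 : 0 < N by rewrite ltr0n.
have p1 : b / N <= 1.
  by rewrite ler_pdivrMr // mul1r (le_trans b1) // ler1n.
rewrite /binom_pmf /poisson_pmf b0.
have -> : b ^+ k / k`!%:R * expR (- b) * expR (b * k.+1%:R / N) =
   (N ^+ k / k`!%:R * (b / N) ^+ k) * expR (- (b / N)) ^+ (n - k).
  rewrite -expRM_natl -!mulrA -expRD.
  have -> : - b + b * (k.+1%:R / N) = (n - k)%:R * - (b / N).
    rewrite natrB // /N -[n.+1%:R]natr1 -[k.+1%:R]natr1; field.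
    by rewrite natr1 pnatr_eq0.
  rewrite expr_div_n !mulrA; congr (_ * _); field.
  by rewrite expf_neq0 ?gt_eqF ?ltr0n ?fact_gt0.
apply: ler_pM.
- by rewrite mulr_ge0 // exprn_ge0 // divr_ge0 // ltW.
- by rewrite exprn_ge0 // subr_ge0.
- apply: ler_wpM2r; first by rewrite exprn_ge0 // divr_ge0 // ltW.
  rewrite ler_pdivlMr ?ltr0n ?fact_gt0 // -natrM bin_ffact /N -natrX ler_nat.
  rewrite (leq_trans (ffact_le_exp _ _)) //.
  by case: (k) => // k'; rewrite leq_exp2r.
- by apply: lerXn2r; rewrite ?nnegrE ?subr_ge0 ?expR_ge0 // expR_ge1Dx.
Qed.

Definition poisson_beta_partial (R : realType) (b : R) (m : nat) : R :=
  \sum_(i < m) \sum_(j < m)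
     poisson_pmf b i * poisson_pmf b j * (1 + (maxn i j)%:R)^-1.

(* Terms with max(i, j) >= m contribute at most 1 / (1 + m). *)
Lemma binom_beta_le (R : realType) (b : R) n m : 0 < b <= 1 -> (m <= n)%N ->
  binom_beta n (b / n.+1%:R) <=
    expR (2 * b * m%:R / n.+1%:R) * poisson_beta_partial b m + m.+1%:R^-1.
Proof.
move=> b01 mn; have [b0 b1] := andP b01.
set p := b / _; have p01 : 0 <= p <= 1.
  apply/andP; split; first by rewrite divr_ge0 // ltW.
  rewrite ler_pdivrMr ?ltr0n // mul1r (le_trans b1) //.
  by rewrite ler1n.
have B0 i : 0 <= binom_pmf n p i by exact: binom_pmf_ge0.
have P0 i : 0 <= poisson_pmf b i by exact: poisson_pmf_ge0.
(* The error term is spread over all pairs by their total mass 1, which makes the comparison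
   termwise. *)
have <- : \sum_(i < n.+1) \sum_(j < n.+1)
    binom_pmf n p i * binom_pmf n p j / m.+1%:R = m.+1%:R^-1.
  under eq_bigr do rewrite -mulr_suml -mulr_sumr sum_binom_pmf mulr1.
  by rewrite -mulr_suml sum_binom_pmf mul1r.
have -> : expR (2 * b * m%:R / n.+1%:R) * poisson_beta_partial b m =
  \sum_(i < n.+1 | (i < m)%N) \sum_(j < n.+1 | (j < m)%N)
     expR (2 * b * m%:R / n.+1%:R) *
     (poisson_pmf b i * poisson_pmf b j * (1 + (maxn i j)%:R)^-1).
  rewrite -(big_ord_widen n.+1 (fun i => \sum_(j < n.+1 | (j < m)%N)
     expR (2 * b * m%:R / n.+1%:R) *
     (poisson_pmf b i * poisson_pmf b j * (1 + (maxn i j)%:R)^-1))) 1?ltnW //.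
  rewrite mulr_sumr; apply: eq_bigr => i _.
  rewrite -(big_ord_widen n.+1 (fun j => expR (2 * b * m%:R / n.+1%:R) *
     (poisson_pmf b i * poisson_pmf b j * (1 + (maxn i j)%:R)^-1))) 1?ltnW //.
  by rewrite mulr_sumr.
rewrite /binom_beta !pair_big /= [X in _ <= X + _]big_mkcond -big_split /=.
apply: ler_sum => -[i j] _ /=.
have f0 : 0 <= (1 + (maxn i j)%:R)^-1 :> R by rewrite invr_ge0 addr_ge0.
have BB0 : 0 <= binom_pmf n p i * binom_pmf n p j by rewrite mulr_ge0.
rewrite -gtn_max; case: ifPn => ijm; last first.
  have -> : 1 + (maxn i j)%:R = (maxn i j).+1%:R :> R by rewrite addrC natr1.
  by rewrite add0r ler_wpM2l // lef_pV2 ?posrE ?ltr0n // ler_nat ltnS leqNgt.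
rewrite -[leLHS]addr0; apply: lerD; last by rewrite divr_ge0.
rewrite mulrA; apply: ler_wpM2r => //.
(* As [k < m], the [k.+1] in the exponent is at most [m]; the factors for [i] and [j] together
   produce the 2. *)
have le1 (k : 'I_n.+1) : (k < m)%N -> binom_pmf n p k <=
    poisson_pmf b k * expR (b * m%:R / n.+1%:R).
  move=> km; apply: (le_trans (binom_pmf_le_poisson b01 _)).
    by rewrite -ltnS.
  apply: ler_wpM2l => //; rewrite ler_expR ler_wpM2r ?invr_ge0 //.
  by rewrite ler_wpM2l ?ler_nat // ltW.
move: ijm; rewrite gtn_max => /andP[im jm].
apply: (le_trans (ler_pM (B0 _) (B0 _) (le1 i im) (le1 j jm))).
rewrite le_eqVlt; apply/orP; left; apply/eqP.
have -> : 2 * b * m%:R / n.+1%:R = b * m%:R / n.+1%:R + b * m%:R / n.+1%:R :> R.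
  by rewrite -!mulrA mulr_natl mulr2n.
by rewrite expRD; ring.
Qed.

Lemma le_beta_of_binom (R : realType) (b c : R) : 0 < b <= 1 ->
  (forall n, c <= binom_beta n (b / n.+1%:R)) -> (c%:E <= beta b)%E.
Proof.
move=> b01 cB; have [b0 b1] := andP b01.
have partial_le m : ((poisson_beta_partial b m)%:E <= beta b)%E.
  apply: le_trans (beta_ge_sum b m); rewrite -sumEFin.
  apply: lee_sum => i _; rewrite -sumEFin; apply: lee_sum => j _.
  by rewrite !poisson_prob_set1 // -!EFinM.
(* An infinite value [+oo] is trivial, and [-oo] contradicts the empty partial sum. *)
case: (beta b) partial_le => [s|_|/(_ 0%N)] //; last exact: leey.
move=> partial_le; rewrite lee_fin.
(* [harmonic m] is [1 / (m + 1)]; it bounds both the tail and the fraction in the exponent. *)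
pose u m : R := expR (2 * b * harmonic m) * s + harmonic m.
have cu m : c <= u m.
  (* Take n + 1 = (m + 1) ^ 2, so that m / (n + 1) <= 1 / (m + 1). *)
  have mn : (m <= m * m.+2)%N by rewrite leq_pmulr.
  apply: (le_trans (cB (m * m.+2)%N)).
  apply: (le_trans (binom_beta_le b01 mn)); apply: lerD; last by [].
  have s0 : 0 <= s.
    by have := partial_le 0%N; rewrite lee_fin /poisson_beta_partial big_ord0.
  have := partial_le m; rewrite lee_fin => ps.
  apply: le_trans (_ : _ <= expR (2 * b * m%:R / (m * m.+2).+1%:R) * s) _.
    by rewrite ler_wpM2l ?expR_ge0.
  rewrite ler_wpM2r // ler_expR -mulrA ler_wpM2l ?mulr_ge0 ?(ltW b0) //.
  rewrite /harmonic ler_pdivrMr ?ltr0n // mulrC ler_pdivlMr ?ltr0n //.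
  by rewrite -natrM ler_nat leqW // leq_mul2l leqnSn orbT.
have uc : (u @ \oo --> expR (2 * b * 0) * s + 0)%classic.
  apply: cvgD; last exact: cvg_harmonic.
  apply: cvgMl; apply: continuous_cvg; first exact: continuous_expR.
  by apply: cvgMr; exact: cvg_harmonic.
have -> : s = expR (2 * b * 0) * s + 0 by rewrite mulr0 expR0 mul1r addr0.
rewrite -(cvg_lim _ uc) //; apply: limr_ge; first by apply/cvg_ex; eexists; exact: uc.
by near=> m; exact: cu.
Unshelve. all: by end_near.
Qed.

(** * Complete bipartite graphs *)

(** After exchanging the sums, each outcome is counted once per element satisfying [P], and it has
    at most one. *)
Lemma sum_Pr_le1 (R : realType) (E : finType) (d : fdist R {set E}) (P : pred E) :
  (forall B, d B != 0 -> {in B &, forall e f, P e -> P f -> e = f}) ->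
  \sum_(e | P e) Pr d [pred B : {set E} | e \in B] <= 1.
Proof.
move=> uniq; rewrite -(fdist_sum1 d) /Pr.
under eq_bigr do rewrite big_mkcond.
rewrite exchange_big; apply: ler_sum => B _ /=.
rewrite -big_mkcondr sumr_const /=.
have [->|dB] := eqVneq (d B) 0; first by rewrite mul0rn.
rewrite -[leRHS]mulr1n ler_wpMn2l ?fdist_ge0 //.
apply/card_le1_eqP => e f /andP[Pe eB] /andP[Pf fB].
exact: (uniq B dB).
Qed.

Lemma Pr_eq0 (R : realType) (T : finType) (d : fdist R T) (A : pred T) :
  (forall t, d t != 0 -> ~~ A t) -> Pr d A = 0.
Proof.
by move=> dA; apply: big1 => t At; apply/eqP; apply: contraTT At; exact: dA.
Qed.

Section CompleteBipartite.
Variable I : finType.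

Definition biclique_edge (ij : I * I) : {set I + I} := [set inl ij.1; inr ij.2].

Lemma card_biclique_edge e :
  e \in [set biclique_edge ij | ij : I * I] -> #|e| = 2%N.
Proof. by case/imsetP => ij _ ->; rewrite cards2. Qed.

Definition biclique : sgraph := SGraph card_biclique_edge.

Local Notation E := (edge biclique).

Lemma biclique_bipartite : bipartite biclique.
Proof.
exists [set inl i | i : I] => _ /imsetP[[i j] _ ->].
suff -> : biclique_edge (i, j) :&: [set inl k | k : I] = [set inl i].
  by rewrite cards1.
apply/setP => -[k|k]; rewrite !inE /=.
  by rewrite orbF imset_f ?andbT.
by rewrite andbC; apply/negbTE/negP => /andP[/imsetP[]].
Qed.

Lemma biclique_edge_inj : injective biclique_edge.
Proof.
move=> [i j] [i' j'] /setP eq_ij.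
have := eq_ij (inl i); rewrite !inE eqxx /= orbF => /esym/eqP[->].
by have := eq_ij (inr j); rewrite !inE eqxx /= => /esym/eqP[->].
Qed.

Lemma ex_endpoints (e : E) : exists ij, biclique_edge ij == val e.
Proof. by case/imsetP: (valP e) => ij _ ->; exists ij. Qed.

(** An edge is a bare set of vertices, so its endpoints are recovered by choice; [biclique_edge_inj]
    makes them the only possible ones. *)
Definition endpoints (e : E) : I * I := xchoose (ex_endpoints e).

Definition lend e := (endpoints e).1.
Definition rend e := (endpoints e).2.

Lemma val_biclique (e : E) : val e = [set inl (lend e); inr (rend e)].
Proof. exact/esym/eqP/(xchooseP (ex_endpoints e)). Qed.

Lemma endpoints_bij : bijective (fun e => (lend e, rend e)).
Proof.
have edP ij : biclique_edge ij \in edge_set biclique by exact: imset_f.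
pose ed ij : E := exist _ (biclique_edge ij) (edP ij).
exists ed => [e|ij]; first by apply: val_inj; rewrite [RHS]val_biclique.
by apply: biclique_edge_inj; exact: (esym (val_biclique (ed ij))).
Qed.

(** Two edges meet exactly when they share a left or a right endpoint. *)
Lemma biclique_matchingP (M : {set E}) :
  reflect ({in M &, injective lend} /\ {in M &, injective rend})
    (M \in matchings biclique).
Proof.
rewrite inE; apply: (iffP forall_inP) => [MM|[injl injr] e eM].
  split=> e f eM fM ef; apply/eqP; apply: contraT => nef;
    have /forall_inP/(_ f fM)/implyP/(_ nef) := MM e eM;
    rewrite -setI_eq0 => /eqP/setP.
    by move/(_ (inl (lend e))); rewrite !val_biclique !inE ef !eqxx.
  by move/(_ (inr (rend e))); rewrite !val_biclique !inE ef !eqxx !orbT.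
apply/forall_inP => f fM; apply/implyP => nef.
rewrite -setI_eq0; apply/eqP/setP => -[k|k]; rewrite !val_biclique !inE /=;
  apply/negbTE; apply: contra nef => /andP[].
  by rewrite !orbF => /eqP[->] /eqP[/injl ->].
by move=> /eqP[->] /eqP[/injr ->].
Qed.

End CompleteBipartite.

Section Uniform.
Variables (R : realType) (n : nat).
Local Notation E := (edge (biclique 'I_n.+1)).

(* The uniform point is the average of the n + 1 cyclic shifts. *)
Lemma uniform_in_polytope :
  polytope (matchings (biclique 'I_n.+1)) [ffun e : E => n.+1%:R^-1 : R].
Proof.
pose M (k : 'I_n.+1) : {set E} := [set e | rend e == lend e + k].
have MM k : M k \in matchings (biclique 'I_n.+1).
  apply/biclique_matchingP; split=> e f; rewrite !inE => /eqP re /eqP rf ef.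
    by apply: (bij_inj (@endpoints_bij _)); rewrite re rf ef.
  apply: (bij_inj (@endpoints_bij _)); congr (_, _) => //.
  by apply: (addIr k); rewrite -re -rf.
(* Weighting [A] by the number of shifts equal to it turns sums over matchings into averages over
   [k]. *)
have sumM (h : {set E} -> R) : \sum_(A in matchings (biclique 'I_n.+1))
    (\sum_(k < n.+1) (A == M k)%:R / n.+1%:R) * h A =
    \sum_(k < n.+1) h (M k) / n.+1%:R.
  under eq_bigr do rewrite mulr_suml.
  rewrite exchange_big; apply: eq_bigr => k _ /=.
  rewrite (bigD1 (M k)) //= big1 ?addr0 => [|A /andP[_ /negbTE ->]].
    by rewrite eqxx mul1r mulrC.
  by rewrite !mul0r.
exists (fun A => \sum_(k < n.+1) (A == M k)%:R / n.+1%:R); split.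
- by move=> A _; apply: sumr_ge0 => k _; rewrite divr_ge0.
- transitivity (\sum_(k < n.+1) (1 : R) / n.+1%:R).
    by rewrite -(sumM (fun=> 1)); apply: eq_bigr => A _; rewrite mulr1.
  rewrite sumr_const card_ord mul1r -[LHS]mulr_natl.
  by rewrite divff // pnatr_eq0.
move=> e; rewrite (sumM (fun A => (e \in A)%:R)) ffunE.
(* The only shift through [e] is the difference of its endpoints modulo [n + 1]. *)
rewrite (bigD1 (rend e - lend e)) //= big1 ?addr0.
  by rewrite inE addrC subrK eqxx mul1r.
move=> k ke; rewrite inE [_ == _](_ : _ = false) ?mul0r //.
by apply: contraNF ke => /eqP ->; rewrite addrC addKr.
Qed.

End Uniform.

(** * The bound from one complete bipartite graph *)

Section Bound.
Variables (R : realType) (b c : R) (n : nat).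
Local Notation G := (biclique 'I_n.+1).
Variable pi : cr_procedure R (edge G).
Hypothesis b01 : 0 < b <= 1.
Hypothesis pi_balanced : balanced_cr_scheme b c (matchings G) pi.
Hypothesis pi_monotone : monotone_cr_scheme b (matchings G) pi.

(** At the uniform point, [b > 0] makes the support the whole edge set, so the scheme is constrained
    on every set of edges. Sum the balance condition over all edges, apply [grid_bound], and divide
    by [#|edge G| * p]. *)
Lemma balance_le_binom_beta : c <= binom_beta n (b / n.+1%:R).
Proof.
have /andP[b0 b1] := b01.
set p := b / n.+1%:R.
have p0 : 0 < p by rewrite divr_gt0 // ltr0n.
have p1 : p <= 1.
  by rewrite ler_pdivrMr ?ltr0n // mul1r (le_trans b1) // ler1n.
pose x : {ffun edge G -> R} := [ffun=> p].
have xP : scaled b (polytope (matchings G)) x.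
  exists [ffun e : edge G => n.+1%:R^-1 : R]; first exact: uniform_in_polytope.
  by move=> e; rewrite !ffunE.
have suppx : supp x = setT.
  by apply/setP => e; rewrite !inE ffunE gt_eqF.
have [piA pi_c] := pi_balanced xP.
pose q (A : {set edge G}) e := Pr (pi x A) [pred B : {set edge G} | e \in B].
have Asupp (A : {set edge G}) : A \subset supp x by rewrite suppx finset.subsetT.
have q_out (A : {set edge G}) e : e \notin A -> q A e = 0.
  move=> eA; apply: Pr_eq0 => B /(piA _ (Asupp A)) [BA _] /=.
  by apply: contra eA; apply: (subsetP BA).
have q_mono e (A B : {set edge G}) : e \in A -> A \subset B -> q B e <= q A e.
  by move=> eA AB; apply: (pi_monotone xP).
have ql i (S : {set edge G}) : \sum_(e in S | lend e == i) q S e <= 1.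
  apply: sum_Pr_le1 => B /(piA _ (Asupp S)) [_ /biclique_matchingP[injl _]].
  move=> e f eB fB /andP[_ /eqP le] /andP[_ /eqP lf].
  by apply: injl; rewrite ?le ?lf.
have qr i (S : {set edge G}) : \sum_(e in S | rend e == i) q S e <= 1.
  apply: sum_Pr_le1 => B /(piA _ (Asupp S)) [_ /biclique_matchingP[_ injr]].
  move=> e f eB fB /andP[_ /eqP re] /andP[_ /eqP rf].
  by apply: injr; rewrite ?re ?rf.
have p01 : 0 <= p <= 1 by rewrite (ltW p0).
have := grid_bound p01 (card_ord _) (@endpoints_bij _) q_mono ql qr.
(* The indicator of [e \in A] can be inserted because the scheme selects only inside [A]. *)
have sel e : expect p [set: edge G] (fun A => (e \in A)%:R * q A e) =
    selection_prob pi x e.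
  rewrite /selection_prob suppx; apply: eq_bigr => A _.
  have -> : random_set_pmf x A = p ^+ #|A| * (1 - p) ^+ #|[set: edge G] :\: A|.
    rewrite /random_set_pmf finset.setTD -!prodr_const.
    by congr (_ * _); apply: eq_bigr => f _; rewrite ffunE.
  congr (_ * _); rewrite -/(q A e).
  by case: (boolP (e \in A)) => [_|/q_out ->]; rewrite ?mul1r ?mulr0.
have -> : \sum_e expect p [set: edge G] (fun A => (e \in A)%:R * q A e) =
    \sum_e selection_prob pi x e by apply: eq_bigr => e _; exact: sel.
move=> sel_le.
have E0 : 0 < #|edge G|%:R :> R.
  by rewrite ltr0n (bij_eq_card (@endpoints_bij _)) card_prod card_ord.
have : #|edge G|%:R * (p * c) <= #|edge G|%:R * (p * binom_beta n p).
  apply: le_trans sel_le; rewrite mulr_natl -sumr_const; apply: ler_sum => e _.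
  by rewrite mulrC; have := pi_c e; rewrite suppx inE ffunE; apply.
by rewrite !ler_pM2l.
Qed.

End Bound.

Theorem theorem7 (R : realType) (b c : R)
    (hb : 0 <= b <= 1) (hc : 0 <= c <= 1)
    (pi : forall G : sgraph, cr_procedure R (edge G))
    (hbalanced : forall G : sgraph, bipartite G ->
       balanced_cr_scheme b c (matchings G) (pi G))
    (hmonotone : forall G : sgraph, bipartite G ->
       monotone_cr_scheme b (matchings G) (pi G)) :
  (c%:E <= beta b)%E.
Proof.
have /andP[b0 b1] := hb; have /andP[_ c1] := hc.
move: b0; rewrite le_eqVlt => /orP[/eqP <-|b0].
  (* At rate 0 the Poisson law is the Dirac measure at 0, so the term at [(0, 0)] already gives
     [beta 0 >= 1 >= c]. *)
  apply: le_trans (beta_ge_sum 0 1).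
  by rewrite !big_ord1 /= poisson0_set1 !mul1e addr0 invr1 lee_fin.
have b01 : 0 < b <= 1 by rewrite b0.
apply: le_beta_of_binom => // n.
have biG := @biclique_bipartite 'I_n.+1.
exact: (balance_le_binom_beta b01 (hbalanced _ biG) (hmonotone _ biG)).
Qed.
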